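(* Let $\Omega\subset\mathbb{R}^N$ be a regular bounded open set, let $0<\gamma<|\Omega|$, $0<c_1<c_2$ and $0<\rho_1<\rho_2$, and consider the problem $$\max_{\theta\in\mathrm{ad}^*_\gamma}\ \lambda_1(\theta),\qquad \lambda_1(\theta)=\inf_{u\in H_0^1(\Omega)\setminus\{0\}}\frac{\int_\Omega (c_1+(c_2-c_1)\theta)\,|\nabla u|^2\,dx}{\int_\Omega(\rho_1+(\rho_2-\rho_1)\theta)\,u^2\,dx},$$ where $$\mathrm{ad}^*_\gamma=\Big\{\theta\in L^\infty(\Omega)\ \Big|\ 0\le\theta\le1\ \text{a.e.},\ \int_\Omega\theta\,dx=\gamma\Big\}.$$ This is a pseudo-concave maximization problem, i.e. $\lambda_1$ is pseudo-concave in the closed convex set $\mathrm{ad}^*_\gamma\subset L^\infty(\Omega)$; and thus every (Clarke) stationary point of the problem is a global maximizer of $\lambda_1$ over $\mathrm{ad}^*_\gamma$.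
   Context: The underlying Banach space is $X=L^\infty(\Omega)$ (real-valued). The function $\lambda_1$ is considered, by the same formula, on an open convex set $D\subset L^\infty(\Omega)$ containing $\mathrm{ad}^*_\gamma$ on which the coefficients stay uniformly positive and bounded, e.g. $D=\{\theta\mid -\varepsilon<\operatorname{ess\,inf}\theta\le\operatorname{ess\,sup}\theta<1+\varepsilon\}$ with $\varepsilon>0$ so small that $c_1-\varepsilon(c_2-c_1)>0$ and $\rho_1-\varepsilon(\rho_2-\rho_1)>0$. (The Clarke subdifferential at points of $\mathrm{ad}^*_\gamma$ does not depend on the choice of such $D$.) Clarke subdifferential: for $D\subseteq X$ open and $f:D\to\mathbb{R}$ locally Lipschitz, $$f^\circ(\theta;d)=\limsup_{\theta'\to\theta,\ t\downarrow0}\frac{f(\theta'+td)-f(\theta')}{t},\qquad \partial f(\theta)=\{g\in X^*\mid f^\circ(\theta;d)\ge\langle g,d\rangle_{X^*,X}\ \forall d\in X\}.$$ Pseudo-concavity: a locally Lipschitz $f:D\to\mathbb{R}$ on an open convex set $D$ is pseudo-concave in $D$ if for all $\theta,\theta'\in D$ and all $g\in\partial f(\theta)$, $f(\theta)<f(\theta')$ implies $\langle g,\theta'-\theta\rangle>0$. For a closed convex set $S$, $f$ is pseudo-concave in $S$ if it admits a locally Lipschitz extension to some open convex set $D\supseteq S$ that is pseudo-concave in $D$. A pseudo-concave maximization problem is the maximization of a pseudo-concave function over a closed convex set. Clarke stationary point: for $S\subset D$ nonempty closed convex and $f:D\to\mathbb{R}$ locally Lipschitz, a point $\theta^*\in S$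 is a Clarke stationary point of $\max_{\theta\in S}f(\theta)$ if there is $g\in\partial f(\theta^* )$ such that $\langle g,\theta-\theta^*\rangle\le0$ for all $\theta\in S$. *)

(* Defs.v *)
From HB Require Import structures.
From mathcomp Require Import all_boot all_order all_algebra.
From mathcomp Require Import all_classical all_reals all_analysis.
From mathcomp Require Import measurable_realfun ess_sup_inf.
From mathcomp Require Import lebesgue_integral_fubini lra.

Set Implicit Arguments.
Unset Strict Implicit.
Unset Printing Implicit Defensive.

Import Order.TTheory GRing.Theory Num.Theory.
Import numFieldNormedType.Exports.

Local Open Scope classical_set_scope.
Local Open Scope ring_scope.

Section Lspace_normed.
Local Open Scope quotient_scope.
Context d (T : measurableType d) (R : realType).
Variables (mu : {measure set T -> \bar R}) (p : \bar R) (p1 : (1 <= p)%E).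
Local Notation Lp := (LspaceType mu p1).
Local Notation Lf := (LfunType mu p1).

(* The operations act on representatives; equality in the quotient is equality
   almost everywhere (Lp_eqP). *)
HB.instance Definition _ := gen_eqMixin Lp.
HB.instance Definition _ := gen_choiceMixin Lp.

Definition Lrepr (u : Lp) : Lf :=
  Lfun_Sub p1 (introT andP (conj
    (mem_set (@measurable_funPT _ _ _ _ (repr (u : {mfun_ mu, T >-> measurableTypeR R}))))
    (mem_set (@Lebesgue_finite _ _ _ _ _ _ u)))).

Lemma LreprE (u : Lp) : Lrepr u = u :> (T -> R).
Proof. by []. Qed.



Definition Lfun_mfun (f : Lf) : {mfun T >-> measurableTypeR R} :=
  @mfun_Sub _ _ T (measurableTypeR R) f
    (mem_set (@measurable_funPT _ _ _ _ (f : {mfun T >-> R}))).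

Definition Lcls (f : Lf) : {mfun_ mu, T >-> measurableTypeR R} :=
  \pi_(@aeEqMfun _ _ _ T (measurableTypeR R) mu) (Lfun_mfun f).

Lemma Lcls_ae (f : Lf) : (Lcls f : T -> R) = f %[ae mu].
Proof.
have /eqmodP/asboolP : repr (Lcls f) = Lfun_mfun f
    %[mod {mfun_ mu, T >-> measurableTypeR R}] by rewrite reprK.
by [].
Qed.

Lemma ae_Lnorm (f g : T -> R) : measurable_fun setT f -> measurable_fun setT g ->
   f = g %[ae mu] -> ('N[mu]_p[EFin \o f] = 'N[mu]_p[EFin \o g])%E.
Proof.
move=> mf mg fg; rewrite unlock; case: p => [r| |].
- have mpow (h : T -> R) : measurable_fun setT h ->
      measurable_fun setT (fun x : T => `|((EFin \o h) x)%E| `^ r)%E.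
    move=> mh; apply: (@measurableT_comp _ _ _ _ _ _ (fun x => x `^ r)%E).
      exact: measurable_poweR.
    by apply: measurableT_comp => //; exact/measurable_EFinP.
  congr (_ `^ _)%E; apply: ae_eq_integral => //; [exact: mpow|exact: mpow|].
  by move: fg; apply: filterS => x /= /[apply] ->.
- case: ifPn => // _; apply: eq_ess_sup.
  by move: fg; apply: filterS => x /= /(_ I) ->.
- case: ifPn => // _; apply: eq_ess_inf.
  by move: fg; apply: filterS => x /= /(_ I) ->.
Qed.

Lemma Lcls_finite (f : Lf) : finite_norm mu p (Lcls f).
Proof.
rewrite /finite_norm (@ae_Lnorm _ f) //; first exact: Lfunction_finite.
  exact: (@measurable_funPT _ _ _ _ (repr (Lcls f))).
exact: Lcls_ae.
Qed.

Definition Lproj (f : Lf) : Lp :=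
  @LebesgueSpace.Pack _ _ _ _ _ p1 (Lcls f) (LebesgueSpace.Class (isFinLebesgue.Build _ _ _ _ _ p1 (Lcls f) (Lcls_finite f))).

Lemma LprojE (f : Lf) : (Lproj f : T -> R) = f %[ae mu].
Proof. exact: Lcls_ae. Qed.

Lemma Lp_eqP (u v : Lp) : u = v <-> (u : T -> R) = v %[ae mu].
Proof.
split=> [->|]; first exact: ae_eq_refl.
case: u => u [[pu]]; case: v => v [[pv]] /= uv.
have e : u = v by rewrite -[u]reprK -[v]reprK; apply/eqmodP/asboolP.
rewrite {uv}; move: pu pv; rewrite e => pu pv.
by rewrite (Prop_irrelevance pu pv).
Qed.

Let ae4 (A B C D E : set T) : (forall x, A x -> B x -> C x -> D x -> E x) ->
  (\forall x \ae mu, A x) -> (\forall x \ae mu, B x) ->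
  (\forall x \ae mu, C x) -> (\forall x \ae mu, D x) -> \forall x \ae mu, E x.
Proof.
move=> h a b c e; near=> x; apply: h; near: x.
- exact: a.
- exact: b.
- exact: c.
- exact: e.
Unshelve. all: by end_near. Qed.

Definition Lp_add (u v : Lp) := Lproj (Lrepr u + Lrepr v).
Definition Lp_opp (u : Lp) := Lproj (- Lrepr u).
Definition Lp_scale (a : R) (u : Lp) := Lproj (a *: Lrepr u).

Lemma Lp_addE u v : (Lp_add u v : T -> R) = (u : T -> R) \+ (v : T -> R) %[ae mu].
Proof. exact: LprojE. Qed.
Lemma Lp_oppE u : (Lp_opp u : T -> R) = (\- (u : T -> R)) %[ae mu].
Proof. exact: LprojE. Qed.
Lemma Lp_scaleE a u : (Lp_scale a u : T -> R) = (fun x => a * u x) %[ae mu].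
Proof. exact: LprojE. Qed.
Lemma Lp_0E : (Lproj 0 : T -> R) = cst 0 %[ae mu].
Proof. exact: LprojE. Qed.

Let addA : associative Lp_add.
Proof.
move=> u v w; apply/Lp_eqP.
apply: ae4 (Lp_addE u (Lp_add v w)) (Lp_addE v w)
  (Lp_addE (Lp_add u v) w) (Lp_addE u v) => x /=.
move=> /(_ I) e4 /(_ I) e3 /(_ I) e2 /(_ I) e1 _.
by rewrite e4 e3 e2 e1 addrA.
Qed.
Let addC : commutative Lp_add.
Proof.
move=> u v; apply/Lp_eqP.
have := Lp_addE u v; have := Lp_addE v u.
by apply: filterS2 => x /= /(_ I) e1 /(_ I) e2 _; rewrite e1 e2 addrC.
Qed.
Let add0 : left_id (Lproj 0) Lp_add.
Proof.
move=> u; apply/Lp_eqP.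
have := Lp_addE (Lproj 0) u; have := Lp_0E.
by apply: filterS2 => x /= /(_ I) e1 /(_ I) e2 _; rewrite e2 e1 add0r.
Qed.
Let addN : left_inverse (Lproj 0) Lp_opp Lp_add.
Proof.
move=> u; apply/Lp_eqP.
have := Lp_addE (Lp_opp u) u; have := Lp_oppE u; have := Lp_0E.
apply: filterS3 => x /= /(_ I) e1 /(_ I) e2 /(_ I) e3 _.
by rewrite e3 e2 e1 addNr.
Qed.
HB.instance Definition _ := GRing.isZmodule.Build Lp addA addC add0 addN.

Let scaleA a b (v : Lp) : Lp_scale a (Lp_scale b v) = Lp_scale (a * b) v.
Proof.
apply/Lp_eqP.
have := Lp_scaleE a (Lp_scale b v); have := Lp_scaleE b v; have := Lp_scaleE (a * b) v.
apply: filterS3 => x /= /(_ I) e1 /(_ I) e2 /(_ I) e3 _.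
by rewrite e3 e2 e1 mulrA.
Qed.
Let scale1 : left_id 1 Lp_scale.
Proof.
move=> u; apply/Lp_eqP; have := Lp_scaleE 1 u.
by apply: filterS => x /= /(_ I) e _; rewrite e mul1r.
Qed.
Let scaleDr : right_distributive Lp_scale +%R.
Proof.
move=> a u v; apply/Lp_eqP.
apply: (@ae4 _ _ _ _ _ _ (Lp_scaleE a (u + v)) (Lp_addE u v)
  (Lp_addE (Lp_scale a u) (Lp_scale a v))
  (filterI (Lp_scaleE a u) (Lp_scaleE a v))) => x /=.
move=> /(_ I) e5 /(_ I) e4 /(_ I) e3 [/(_ I) e2 /(_ I) e1] _.
by rewrite e5 [X in _ * X]e4 [RHS]e3 e2 e1 mulrDr.
Qed.
Let scaleDl v : {morph Lp_scale^~ v : a b / a + b}.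
Proof.
move=> a b; apply/Lp_eqP.
apply: ae4 (Lp_scaleE (a + b) v) (Lp_addE (Lp_scale a v) (Lp_scale b v))
  (Lp_scaleE a v) (Lp_scaleE b v) => x /=.
move=> /(_ I) e4 /(_ I) e3 /(_ I) e2 /(_ I) e1 _.
by rewrite e4 [RHS]e3 e2 e1 mulrDl.
Qed.
HB.instance Definition _ :=
  GRing.Zmodule_isLmodule.Build R Lp scaleA scale1 scaleDr scaleDl.

Definition Lp_norm (u : Lp) : R := fine ('N[mu]_p[EFin \o u]).

Lemma Lproj_norm (f : Lf) : Lp_norm (Lproj f) = fine ('N[mu]_p[EFin \o f]).
Proof.
congr fine; apply: ae_Lnorm; last exact: LprojE.
- exact: (@measurable_funPT _ _ _ _ (repr (Lcls f))).
- exact: (@measurable_funPT _ _ _ _ (f : {mfun T >-> R})).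
Qed.

Let normD u v : Lp_norm (u + v) <= Lp_norm u + Lp_norm v.
Proof.
by rewrite Lproj_norm; exact: (ler_LnormD (Lrepr u) (Lrepr v)).
Qed.
Let normZ a u : Lp_norm (a *: u) = `|a| * Lp_norm u.
Proof.
rewrite Lproj_norm; have := LnormZ (Lrepr u) a.
by rewrite -(finite_norm_fine (Lrepr u)) -EFinM => ->.
Qed.
Let norm0 u : Lp_norm u = 0 -> u = 0.
Proof.
move=> /(fine_Lnormr_eq0 (f := Lrepr u)) u0; apply/Lp_eqP.
have := Lp_0E; move: u0.
by apply: filterS2 => x /= /(_ I) e1 /(_ I) e2 _; rewrite [LHS]e1 [RHS]e2.
Qed.
HB.instance Definition _ := Lmodule_isNormed.Build R Lp normD normZ norm0.

Lemma LspaceD (u v : Lp) :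
  ((u + v)%R : T -> R) = (u : T -> R) \+ (v : T -> R) %[ae mu].
Proof. exact: Lp_addE. Qed.

Lemma LspaceN (u : Lp) : ((- u)%R : T -> R) = \- (u : T -> R) %[ae mu].
Proof. exact: Lp_oppE. Qed.

Lemma LspaceZ (a : R) (u : Lp) :
  ((a *: u)%R : T -> R) = (fun x => a * u x) %[ae mu].
Proof. exact: Lp_scaleE. Qed.

Lemma Lspace_normE (u : Lp) : `|u| = fine ('N[mu]_p[EFin \o u]).
Proof. by []. Qed.
End Lspace_normed.


Section cons_measure.
Context d (T : measurableType d) (R : realType) (n : nat).
Variable m1 : {sigma_finite_measure set T -> \bar R}.
Variable m : {sigma_finite_measure set (n.-tuple T) -> \bar R}.

Definition tuple_cons (p : T * n.-tuple T) : n.+1.-tuple T := [tuple of p.1 :: p.2].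

Lemma measurable_tuple_cons : measurable_fun setT tuple_cons.
Proof. exact: measurable_cons. Qed.

Definition cons_measure : set (n.+1.-tuple T) -> \bar R :=
  pushforward (m1 \x m)%E tuple_cons.

Let pm := measure_function_pushforward__canonical__measure_function_Measure
     (m1 \x m)%E measurable_tuple_cons.
HB.instance Definition _ := isMeasure.Build _ _ _ cons_measure
  (measure0 pm) (measure_ge0 pm) (@measure_semi_sigma_additive _ _ _ pm).

Let cons_sigma_finite : sigma_finite setT cons_measure.
Proof.

have /sigma_finiteP[F [FT ndF Foo]] := sigma_finiteT m1.
have /sigma_finiteP[G [GT ndG Goo]] := sigma_finiteT m.
pose uncons (t : n.+1.-tuple T) : T * n.-tuple T := (thead t, [tuple of behead t]).
have munc : measurable_fun setT uncons.
  apply/measurable_fun_pairP; split; first exact: measurable_tnth.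
  exact: measurable_behead.
have unconsK p : uncons (tuple_cons p) = p.
  case: p => x t; congr pair; exact/val_inj.
exists (fun k => uncons @^-1` (F k `*` G k)).
  apply/seteqP; split=> // t _.
  have [k _ Fk] : (\bigcup_k F k) (uncons t).1 by rewrite -FT.
  have [l _ Gl] : (\bigcup_k G k) (uncons t).2 by rewrite -GT.
  exists (maxn k l) => //; split.
  - by move: (_.1) Fk; exact/subsetPset/ndF/leq_maxl.
  - by move: (_.2) Gl; exact/subsetPset/ndG/leq_maxr.
move=> k; have [mF Fk] := Foo k; have [mG Gk] := Goo k; split.
  by rewrite -[X in measurable X]setTI; apply: munc => //; exact: measurableX.
rewrite /cons_measure /pushforward -comp_preimage.
rewrite (_ : _ @^-1` _ = F k `*` G k); last first.
  by rewrite (_ : uncons \o tuple_cons = id)//; apply/funext => p; exact: unconsK.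
by rewrite product_measure1E// lte_mul_pinfty// ge0_fin_numE.
Qed.

HB.instance Definition _ :=
  Measure_isSigmaFinite.Build _ _ _ cons_measure cons_sigma_finite.
End cons_measure.


Section lebesgue_rV.
Variable R : realType.

(* R^n.+1 is seen as R * R^n, with the product measure. *)
Fixpoint lebesgue_tuple (n : nat) :
    {sigma_finite_measure set (n.-tuple (measurableTypeR R)) -> \bar R} :=
  if n is n'.+1
    return {sigma_finite_measure set (n.-tuple (measurableTypeR R)) -> \bar R}
  then cons_measure (@lebesgue_measure R) (lebesgue_tuple n')
  else @dirac _ (0.-tuple (measurableTypeR R)) [tuple] R.


Lemma lebesgue_tuple_box n (a b : 'I_n -> R) : (forall i, a i <= b i) ->
  lebesgue_tuple n [set t : n.-tuple (measurableTypeR R) |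
     forall i, a i <= tnth t i <= b i] = (\prod_(i < n) (b i - a i))%:E.
Proof.
elim: n a b => [|n IHn] a b ab.
  rewrite big_ord0/= (_ : [set _ | _] = setT) ?diracT//.
  by apply/seteqP; split => // t _ [].
rewrite /= /cons_measure /pushforward.
have -> : tuple_cons (n:=n) @^-1`
    [set t | forall i, a i <= tnth t i <= b i] =
  `[a ord0, b ord0]%classic `*`
  [set t : n.-tuple (measurableTypeR R) |
     forall i, a (lift ord0 i) <= tnth t i <= b (lift ord0 i)].
  apply/seteqP; split => -[x t] /=.
    move=> h; split; first by have := h ord0; rewrite in_itv.
    by move=> i; have := h (lift ord0 i); rewrite tnthS.
  rewrite in_itv/= => -[h0 h] i.
  by case: (unliftP ord0 i) => [j|] ->; rewrite ?tnthS.
rewrite product_measure1E.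
- rewrite IHn// big_ord_recl EFinM; congr (_ * _)%E.
  have := ab ord0; rewrite le_eqVlt => /predU1P[->|ab0].
    rewrite subrr set_itv1. exact: lebesgue_measure_set1.
  transitivity (@lebesgue_measure R `[a ord0, b ord0]%classic) => [//|].
  by rewrite lebesgue_measure_itv/= lte_fin ab0 -EFinB.
- exact: measurable_itv.
- rewrite (_ : [set _ | _] = \bigcap_(i in [set: 'I_n])
    ((fun t : n.-tuple (measurableTypeR R) => tnth t i) @^-1`
      `[a (lift ord0 i), b (lift ord0 i)]%classic)).
    apply: fin_bigcap_measurable => // i _.
    rewrite -[X in measurable X]setTI; apply: measurable_tnth => //.
  apply/seteqP; split => [t h i _|t h i]; first by rewrite /= in_itv/=.
  by have := h i I; rewrite /= in_itv.
Qed.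

Definition rV_of_tuple n (t : n.-tuple (measurableTypeR R)) : 'rV[R]_n :=
  \row_(i < n) tnth t i.

Lemma measurable_preimage_rV_of_tuple n (O : set 'rV[R]_n) : open O ->
  measurable (@rV_of_tuple n @^-1` O).
Proof.
move=> oO.
pose box (ab : n.-tuple (rat * rat)) : set (n.-tuple (measurableTypeR R)) :=
  \bigcap_(i in [set: 'I_n]) ((fun t : n.-tuple (measurableTypeR R) => tnth t i) @^-1`
     `]ratr (tnth ab i).1, ratr (tnth ab i).2[%classic).
set P := _ @^-1` O.
have mbox ab : measurable (box ab).
  apply: fin_bigcap_measurable => // i _.
  rewrite -[X in measurable X]setTI; apply: measurable_tnth => //.
pose F ab := if `[< box ab `<=` P >] then box ab else set0.
have -> : P = \bigcup_ab F ab.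
  apply/seteqP; split => [t Pt|t [ab _]]; last by rewrite /F; case: asboolP => // h /h.
  have /nbhs_ballP[e /= e0 he] : nbhs (rV_of_tuple t) O by exact: open_nbhs_nbhs.
  have ex (i : 'I_n) : exists q : rat * rat, [/\ ratr q.1 < (tnth t i : R), (tnth t i : R) < ratr q.2,
      tnth t i - e < ratr q.1 :> R & ratr q.2 < tnth t i + e :> R].
    have : (tnth t i - e < tnth t i :> R) by rewrite ltrBlDr ltrDl.
    move=> /rat_in_itvoo[q1]; rewrite inE/= => /itvP h1.
    have : (tnth t i < tnth t i + e :> R) by rewrite ltrDl.
    move=> /rat_in_itvoo[q2]; rewrite inE/= => /itvP h2.
    by exists (q1, q2); split; rewrite /= ?h1 ?h2.
  have [q hq] := choice ex.
  pose ab := [tuple q i | i < n].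
  exists ab => //; rewrite /F asboolT.
    by move=> i _ /=; rewrite tnth_mktuple in_itv/=; have [-> -> _ _] := hq i.
  move=> t' ht'; apply: he; split => // i j; rewrite !mxE. rewrite /ball/= ltr_norml.
  have [q1 q2 q3 q4] := hq j.
  have /= := ht' j I; rewrite tnth_mktuple in_itv/= => /andP[h1 h2].
  by apply/andP; split; lra.
apply: countable_bigcupT_measurable => [|ab]; first exact: countableP.
by rewrite /F; case: ifP.
Qed.
End lebesgue_rV.

Section borel_rV.
Context (R : realType) (n : nat).

(* 'rV[R]_n carries its Borel sigma-algebra. *)
Let T := g_sigma_algebraType (@open 'rV[R]_n).
HB.instance Definition _ := @isMeasurable.Build (sigma_display (@open 'rV[R]_n)) 'rV[R]_n
  (<<s @open 'rV[R]_n >>) (@measurable0 _ T) (@measurableC _ T) (@bigcupT_measurable _ T).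

Lemma open_measurable_rV (O : set 'rV[R]_n) : open O -> measurable O.
Proof. exact: sub_sigma_algebra. Qed.

Lemma measurable_rV_of_tuple : measurable_fun setT (@rV_of_tuple R n).
Proof.
apply: (@measurability _ _ _ _ _ _ (@open 'rV[R]_n)) => //.
by move=> _ [U oU <-]; rewrite setTI; exact: measurable_preimage_rV_of_tuple.
Qed.

Definition lebesgue_rV : set 'rV[R]_n -> \bar R :=
  pushforward (lebesgue_tuple R n) (@rV_of_tuple R n).
Let pm := measure_function_pushforward__canonical__measure_function_Measure
     (lebesgue_tuple R n) measurable_rV_of_tuple.
HB.instance Definition _ := isMeasure.Build _ _ _ lebesgue_rV
  (measure0 pm) (measure_ge0 pm) (@measure_semi_sigma_additive _ _ _ pm).

Lemma lebesgue_rV_box (a b : 'rV[R]_n) : (forall i, a ord0 i <= b ord0 i) ->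
  lebesgue_rV [set x | forall i, a ord0 i <= x ord0 i <= b ord0 i]
  = (\prod_(i < n) (b ord0 i - a ord0 i))%:E.
Proof.
move=> ab; rewrite -lebesgue_tuple_box// /lebesgue_rV /pushforward.
congr (lebesgue_tuple R n _).
by apply/seteqP; split => t /= h i; have := h i; rewrite mxE.
Qed.

End borel_rV.

Section clarke.
Context (R : realType) (X : normedModType R).
Implicit Types (f : X -> R) (D S : set X) (x d : X).

(* A function defined on an open set D is represented by a total function; all
   the notions below are local at points of D, so that its values outside D are
   irrelevant. *)

Definition clarke_derivative f x d : \bar R :=
  limf_esup (fun p : X * R => ((f (p.1 + p.2 *: d) - f p.1) / p.2)%:E)
    (filter_prod (nbhs x) (at_right 0)).

Definition clarke_subdifferential f x : set {linear X -> R^o} :=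
  [set g | continuous g /\
           forall d, ((g d : R)%:E <= clarke_derivative f x d)%E].

Definition locally_lipschitz_on D f :=
  forall x, D x -> exists2 U, nbhs x U & [lipschitz (f y : R^o) | y in U].

Definition pseudo_concave_on D f :=
  locally_lipschitz_on D f /\
  forall x y g, D x -> D y -> clarke_subdifferential f x g ->
    f x < f y -> 0 < (g (y - x) : R).

Definition pseudo_concave_in S f :=
  exists D (F : X -> R), [/\ open D, convex_set D, S `<=` D,
    {in S, F =1 f} & pseudo_concave_on D F].

Definition pseudo_concave_maximization S f :=
  [/\ closed S, convex_set S & pseudo_concave_in S f].

Definition clarke_stationary S f x :=
  S x /\ exists2 g, clarke_subdifferential f x g &
         forall y, S y -> (g (y - x) : R) <= 0.

Definition global_maximizer S f x := S x /\ forall y, S y -> f y <= f x.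
End clarke.

Section domains.
Context (R : realType) (n : nat).
Implicit Types (Omega : set 'rV[R]_n).

(* The boundary is locally the graph of a Lipschitz function psi in the
   direction e: psi is a function of the component orthogonal to the unit
   vector e, written as a function on the whole space invariant along e. *)
Definition lipschitz_boundary Omega :=
  forall x, (closure Omega `\` Omega°) x ->
  exists (e : 'rV[R]_n) (psi : 'rV[R]_n -> R^o) (r : R),
    [/\ \sum_(i < n) e ord0 i ^+ 2 = 1,
        lipschitz psi,
        forall y t, psi (y + t *: e) = psi y,
        0 < r &
        forall y, ball x r y ->
          (Omega y <-> psi y < \sum_(i < n) y ord0 i * e ord0 i)].

Definition partial (i : 'I_n) (phi : 'rV[R]_n -> R^o) : 'rV[R]_n -> R^o :=
  fun x => 'D_(delta_mx ord0 i) phi x.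

Fixpoint Ck (k : nat) (phi : 'rV[R]_n -> R^o) : Prop :=
  continuous phi /\
  if k is k'.+1 then
    forall i, (forall x, derivable phi x (delta_mx ord0 i)) /\
              Ck k' (partial i phi)
  else True.

Definition test_function Omega : set ('rV[R]_n -> R^o) :=
  [set phi | [/\ forall k, Ck k phi,
     compact (closure [set x | phi x != 0]) &
     closure [set x | phi x != 0] `<=` Omega]].
End domains.

Section eigenvalue.
Context (R : realType) (n : nat) (Omega : set 'rV[R]_n).
Variable Omega_open : open Omega.

(* Functions on Omega are represented by functions on R^n, considered up to
   equality almost everywhere on Omega. *)
Definition domain_measure : {measure set 'rV[R]_n -> \bar R} :=
  mrestr (@lebesgue_rV R n) (open_measurable_rV Omega_open).
Local Notation mu := domain_measure.

Definition Linfty := LspaceType mu (leey 1%E).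

Definition norm2 (v : 'rV[R]_n) : R := \sum_(i < n) v ord0 i ^+ 2.

Definition weak_gradient (u : 'rV[R]_n -> R) (G : 'rV[R]_n -> 'rV[R]_n) :=
  forall phi, test_function Omega phi -> forall i,
    \int[mu]_x (u x * partial i phi x) = - \int[mu]_x (G x ord0 i * phi x).

Definition H1 (u : 'rV[R]_n -> R) (G : 'rV[R]_n -> 'rV[R]_n) :=
  [/\ u \in Lfun mu 2%:E, forall i, (fun x => G x ord0 i) \in Lfun mu 2%:E &
      weak_gradient u G].

(* H10 u G: u is in H^1_0(Omega), the H^1-closure of the test functions, and G
   is its weak gradient (unique up to a.e. equality). *)
Definition H10 (u : 'rV[R]_n -> R) (G : 'rV[R]_n -> 'rV[R]_n) :=
  H1 u G /\
  exists2 phi : nat -> 'rV[R]_n -> R^o, forall k, test_function Omega (phi k) &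
    (\int[mu]_x ((phi k x - u x) ^+ 2
       + norm2 (\row_i partial i (phi k) x - G x))%:E)%E @[k --> \oo] --> 0%E.

Definition rayleigh (c1 c2 rho1 rho2 : R) (theta : Linfty) u G : R :=
  (\int[mu]_x ((c1 + (c2 - c1) * theta x) * norm2 (G x))) /
  (\int[mu]_x ((rho1 + (rho2 - rho1) * theta x) * u x ^+ 2)).

Definition lambda1 (c1 c2 rho1 rho2 : R) (theta : Linfty) : R :=
  inf [set q | exists u G, [/\ H10 u G, ~ (u = cst 0 %[ae mu]) &
                               q = rayleigh c1 c2 rho1 rho2 theta u G]].

Definition adstar (gamma : R) : set Linfty :=
  [set theta : Linfty | (\forall x \ae mu, 0 <= theta x <= 1) /\
                        \int[mu]_x theta x = gamma].

Definition admissible_extension_domain (c1 c2 rho1 rho2 gamma : R)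
    (D : set Linfty) :=
  [/\ open D, convex_set D, adstar gamma `<=` D &
   exists m M : R, 0 < m /\ forall theta, D theta -> \forall x \ae mu,
     (m <= c1 + (c2 - c1) * theta x <= M) /\
     (m <= rho1 + (rho2 - rho1) * theta x <= M)].
End eigenvalue.

Arguments rayleigh {R n Omega} Omega_open c1 c2 rho1 rho2 theta u G.
Arguments lambda1 {R n Omega} Omega_open c1 c2 rho1 rho2 theta.
Arguments adstar {R n Omega} Omega_open gamma.
Arguments admissible_extension_domain {R n Omega} Omega_open
  c1 c2 rho1 rho2 gamma D.

(* Main.v *)
Require Import Defs.
From mathcomp Require Import all_boot all_order all_algebra.
From mathcomp Require Import all_classical all_reals all_analysis.
From mathcomp Require Import measurable_realfun ess_sup_inf.
From mathcomp Require Import ring lra.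

Set Implicit Arguments.
Unset Strict Implicit.
Unset Printing Implicit Defensive.

Import Order.TTheory GRing.Theory Num.Theory.
Import numFieldNormedType.Exports.

Local Open Scope classical_set_scope.
Local Open Scope ring_scope.

(** The eigenvalue lambda1 is an infimum, over the competitors (u, grad u), of
quotients A_u(theta) / B_u(theta) in which both the numerator and the denominator
are affine in theta, the numerator is nonnegative and the denominator positive on
the domain D.  Every infimum f of this form over an open set D is locally
Lipschitz and pseudo-concave on D ([inf_ratio_pseudo_concave]).

Local Lipschitz continuity comes from a Harnack inequality.  An affine functional
that is nonnegative at x - v satisfies a(x + s v) <= (1 + s) a(x), with a constant
independent of the functional ([affine_functional_harnack]).  Applied to every
numerator and denominator on a ball contained in D, it bounds the ratio of two
values of f by a factor (1 + t)^2, with t proportional to the distance of the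
points ([inf_ratio_ball_harnack]).

Pseudo-concavity is an estimate on chords.  Let f(x) < f(y), and consider a
difference quotient of f in the direction x - y, between a point eta near x and
zeta = eta + t (x - y).  With omega = zeta + (y - x), which is near y, one has
eta = (1 - t) zeta + t omega.  As A_u and B_u are affine and f B_u <= A_u,

  A_u(eta) >= f(zeta) B_u(eta) + t (f(omega) - f(zeta)) B_u(omega).

The Harnack inequality for B_u along the segment from eta to omega, slightly
prolonged beyond omega inside the open set D, gives B_u(omega) >= k B_u(eta) with
k > 0 independent of u.  Hence f(eta) >= f(zeta) + t k (f(omega) - f(zeta))
([inf_ratio_chord_increase]), so that the difference quotients stay below a
negative constant.  The Clarke derivative of f at x in the direction x - y is
therefore negative ([inf_ratio_clarke_lt0]), and every Clarke subgradient at x is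
positive on y - x.

What is left is measure theory: the weighted integrals are affine on L^oo, and a
uniform positive lower bound of the coefficients makes the denominators positive
([lambda1_pseudo_concave]); the admissible set is convex, and closed because a
bounded set has finite measure.  A neighbourhood of the admissible set of small
uniform radius serves as the domain of the extension
([exists_admissible_extension_domain]).  On it pseudo-concavity forbids a
stationary point from having a smaller value than another admissible point: the
subgradient would be positive on the direction that leads to that point. *)

(** * Lipschitz functions and convex sets *)

Lemma locally_lipschitz_continuous (R : realType) (X : normedModType R)
    (D : set X) (f : X -> R^o) x :
  locally_lipschitz_on D f -> D x -> {for x, continuous f}.
Proof.
move=> lf Dx; have [U nU [M [_ /(_ (`|M| + 1))]]] := lf _ Dx.
rewrite (le_lt_trans (ler_norm _)) ?ltrDl// => /(_ isT) LM.
have Ux : U x by exact: nbhs_singleton.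
apply/cvgrPdist_lt => e e0; near=> y.
have M0 : 0 < `|M| + 1 by rewrite ltr_wpDl.
apply: (@le_lt_trans _ _ ((`|M| + 1) * `|x - y|)).
  by apply: (LM (x, y)); split => //=; near: y.
rewrite mulrC -ltr_pdivlMr//; near: y.
by apply: (cvgr_dist_lt id x cvg_id); rewrite divr_gt0.
Unshelve. all: by end_near. Qed.

(** Convex sets are defined through the abstract averages of a convex space; this
is the criterion in terms of the linear structure. *)
Lemma segment_convex_set (R : realType) (V : lmodType R) (A : set V) :
  (forall x y (t : R), 0 <= t <= 1 -> A x -> A y -> A (x + t *: (y - x))) ->
  convex_set A.
Proof.
move=> seg x y t; rewrite !inE => Ax Ay.
have -> : conv t x y = y + t%:num *: (x - y).
  rewrite -[LHS]/(t%:num *: (x : V) + (1 - t%:num) *: (y : V)).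
  by rewrite scalerBl scale1r scalerBr addrCA.
by apply: seg => //; rewrite ge0 le1.
Qed.

(** * Infima of ratios of affine functionals *)

Section inf_of_affine_ratios.
Context (R : realType) (X : normedModType R).
Implicit Types (D : set X) (x y v : X).

Definition affine_functional (a : X -> R) :=
  forall x y t, a (x + t *: (y - x)) = a x + t * (a y - a x).

(** The point x lies between x - v and x + s v, and divides this segment in the
ratio 1 : s; so a(x) is at least the share 1 / (1 + s) of a(x + s v). *)
Lemma affine_functional_harnack (a : X -> R) x v s :
  affine_functional a -> 0 <= a (x - v) -> 0 <= s ->
  a (x + s *: v) <= (1 + s) * a x.
Proof.
move=> aff a0 s0; have := aff x (x - v) (- s).
rewrite (_ : x - v - x = - v); last by rewrite addrAC subrr add0r.
rewrite scaleNr scalerN opprK => ->; nra.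
Qed.

Variables (I : Type) (P : set I) (a b : I -> X -> R) (D : set X).
Hypothesis affa : forall i, P i -> affine_functional (a i).
Hypothesis affb : forall i, P i -> affine_functional (b i).
Hypothesis a_ge0 : forall i x, P i -> D x -> 0 <= a i x.
Hypothesis b_gt0 : forall i x, P i -> D x -> 0 < b i x.

Definition inf_ratio x : R := inf [set a i x / b i x | i in P].

Lemma inf_ratio_set0 x : P = set0 -> inf_ratio x = 0.
Proof. by move=> P0; rewrite /inf_ratio P0 image_set0 inf0. Qed.

Let inf_ratio_has_lbound x : D x -> has_lbound [set a i x / b i x | i in P].
Proof.
move=> Dx; exists 0 => _ [i Pi <-].
by rewrite divr_ge0 ?a_ge0 ?(ltW (b_gt0 _ _)).
Qed.

Lemma inf_ratio_ge0 x : D x -> 0 <= inf_ratio x.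
Proof.
move=> Dx; have [P0|/set0P P0] := eqVneq P set0.
  by rewrite inf_ratio_set0.
apply: lb_le_inf; first by case: P0 => i Pi; exists (a i x / b i x), i.
by move=> _ [i Pi <-]; rewrite divr_ge0 ?a_ge0 ?(ltW (b_gt0 _ _)).
Qed.

Lemma inf_ratio_mul_le i x : P i -> D x -> inf_ratio x * b i x <= a i x.
Proof.
move=> Pi Dx; rewrite -ler_pdivlMr ?b_gt0//.
by apply: ge_inf; [exact: inf_ratio_has_lbound|exists i].
Qed.

Lemma le_inf_ratio c x : P !=set0 -> D x ->
  (forall i, P i -> c * b i x <= a i x) -> c <= inf_ratio x.
Proof.
move=> [i0 Pi0] Dx h; apply: lb_le_inf.
  by exists (a i0 x / b i0 x), i0.
by move=> _ [i Pi <-]; rewrite ler_pdivlMr ?b_gt0 ?h.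
Qed.

(** Numerators grow by a factor at most 1 + s from x to x + s v, and denominators,
seen from x + s v with the opposite direction, shrink by at most the same factor;
hence the square. *)
Lemma inf_ratio_harnack x v s : P !=set0 -> 0 <= s ->
  D x -> D (x - v) -> D (x + s *: v) -> D (x + s *: v + v) ->
  inf_ratio (x + s *: v) <= (1 + s) ^+ 2 * inf_ratio x.
Proof.
move=> P0 s0 Dx Dm Dy Dp; rewrite mulrC -ler_pdivrMr ?exprn_gt0; [|nra..].
apply: le_inf_ratio => // i Pi; rewrite mulrAC ler_pdivrMr; last by nra.
have ha := affine_functional_harnack (affa Pi) (a_ge0 Pi Dm) s0.
have := @affine_functional_harnack _ (x + s *: v) (- v) s (affb Pi).
rewrite opprK scalerN addrK => /(_ (ltW (b_gt0 Pi Dp)) s0) hb.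
have hy := inf_ratio_mul_le Pi Dy; have f0 := inf_ratio_ge0 Dy.
apply: (@le_trans _ _ (inf_ratio (x + s *: v) * ((1 + s) * b i (x + s *: v)))).
  by rewrite ler_wpM2l.
rewrite mulrCA; apply: (@le_trans _ _ ((1 + s) * ((1 + s) * a i x))).
  by rewrite ler_wpM2l ?(le_trans hy)//; nra.
by rewrite mulrA -expr2 mulrC.
Qed.

(** The direction v of the Harnack inequality is the one of z - y, of length
r / 2: points of the ball of radius r / 4 stay in the ball of radius r when they
are moved by v. *)
Lemma inf_ratio_ball_harnack x r y z : P !=set0 -> 0 < r ->
  ball x r `<=` D -> ball x (r / 4) y -> ball x (r / 4) z ->
  inf_ratio z <= (1 + `|y - z| / (r / 2)) ^+ 2 * inf_ratio y.
Proof.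
move=> P0 r0 rD; rewrite -ball_normE /= => xy xz.
have inD w v : `|x - w| < r / 4 -> `|v| = r / 2 -> D (w + v).
  move=> xw vr; apply: rD; rewrite -ball_normE /= opprD addrA.
  by apply: le_lt_trans (ler_normB _ _) _; rewrite vr; lra.
have inD0 w : `|x - w| < r / 4 -> D w.
  by move=> xw; apply: rD; rewrite -ball_normE /=; lra.
have [<-|yz] := eqVneq y z.
  by rewrite subrr normr0 mul0r addr0 expr1n mul1r.
set s := _ / _; have s0 : 0 < s.
  by rewrite divr_gt0 ?normr_gt0 ?subr_eq0//; lra.
pose v := s^-1 *: (z - y).
have zE : z = y + s *: v by rewrite scalerA divff ?gt_eqF// scale1r subrKC.
have nv : `|v| = r / 2.
  rewrite normrZ gtr0_norm ?invr_gt0// distrC /s invf_div.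
  by rewrite -mulrA mulVf ?mulr1// normr_eq0 subr_eq0.
rewrite [in X in X <= _]zE; apply: inf_ratio_harnack => //; rewrite ?(ltW s0)//.
- exact: inD0.
- by apply: inD => //; rewrite normrN.
- by rewrite -zE; exact: inD0.
- by rewrite -zE; exact: inD.
Qed.

Hypothesis openD : open D.

Lemma inf_ratio_lipschitz : locally_lipschitz_on D inf_ratio.
Proof.
move=> x Dx; have [P0|/set0P P0] := eqVneq P set0.
  exists setT; first exact: filterT.
  have gx : ([set: X] `*` [set: X]) (x, x) by [].
  apply: (@klipschitzW _ _ _ 0 _ _ (globally_properfilter gx)) => -[y z] _ /=.
  by rewrite !inf_ratio_set0// subrr normr0 mul0r.
have /nbhs_ballP[r /= r0 rD] : nbhs x D by exact: open_nbhs_nbhs.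
exists (ball x (r / 4)); first by apply: nbhsx_ballx; lra.
have fx0 := inf_ratio_ge0 Dx.
(* With t = 2 |y - z| / r <= 1: f z - f y <= (2 t + t ^ 2) f y <= 3 t f y, and
   f y <= 4 f x, so that f z - f y <= 12 t f x. *)
pose L := 24 / r * inf_ratio x.
have xx : ball x (r / 4) x by apply: ballxx; lra.
have gx : (ball x (r / 4) `*` ball x (r / 4)) (x, x) by [].
apply: (@klipschitzW _ _ _ L _ _ (globally_properfilter gx)) => -[y z] [/= xy xz].
wlog fyz : y z xy xz / inf_ratio y <= inf_ratio z.
  move=> H; have [|/ltW] := leP (inf_ratio y) (inf_ratio z); first exact: H.
  by move=> /H; rewrite distrC (distrC z); exact.
rewrite distrC ger0_norm ?subr_ge0//.
have Dy : D y.
  by apply: rD; move: xy; rewrite -ball_normE /= => xy; lra.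
have fy0 := inf_ratio_ge0 Dy.
have := inf_ratio_ball_harnack P0 r0 rD xy xz.
have := inf_ratio_ball_harnack P0 r0 rD xx xy.
move: xy xz; rewrite -ball_normE /= => xy xz.
have yz : `|y - z| < r / 2.
  rewrite -(subrKA x); apply: le_lt_trans (ler_normD _ _) _.
  rewrite distrC; apply: lt_le_trans (ltrD xy xz) _; lra.
have small w : 0 <= w -> w < r / 2 -> 0 <= w / (r / 2) <= 1.
  move=> w0 wr; have r2 : 0 < r / 2 by lra.
  by rewrite divr_ge0 ?(ltW r2)//= ler_pdivrMr// mul1r ltW.
have xy2 : `|x - y| < r / 2.
  by apply: lt_trans xy _; lra.
have /andP[s0 s1] := small _ (normr_ge0 (x - y)) xy2.
have /andP[t0 t1] := small _ (normr_ge0 (y - z)) yz.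
have -> : L * `|y - z| = 12 * (`|y - z| / (r / 2)) * inf_ratio x.
  by rewrite /L; field; rewrite gt_eqF.
set s := _ / _ in s0 s1 *; set t := _ / _ in t0 t1 *.
move=> h1 h2.
have h3 : inf_ratio y <= 4 * inf_ratio x.
  by apply: le_trans h1 _; apply: ler_wpM2r => //; rewrite expr2; nra.
have h4 : inf_ratio z - inf_ratio y <= 3 * t * inf_ratio y.
  rewrite lerBlDr; apply: le_trans h2 _.
  rewrite -[X in _ <= _ + X]mul1r -mulrDl.
  by apply: ler_wpM2r => //; rewrite expr2; nra.
apply: le_trans h4 _; have := ler_wpM2l (mulr_ge0 (ler0n R 3) t0) h3.
by rewrite !mulrA; lra.
Qed.

(** Along a chord from x to y with f(x) <= f(y), an infimum of affine functionals
would increase at least at the rate f(y) - f(x).  For ratios the rate is damped by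
s / (1 + s), a bound from below for the quotient of the denominators at y and z;
s measures how far the segment from z to y is prolonged beyond y inside D. *)
Lemma inf_ratio_chord_increase x y t s (z := x + t *: (y - x)) :
  P !=set0 -> 0 <= t <= 1 -> 0 < s ->
  D x -> D y -> D z -> D (y + s *: (y - z)) -> inf_ratio x <= inf_ratio y ->
  inf_ratio x + t * (s / (1 + s)) * (inf_ratio y - inf_ratio x) <= inf_ratio z.
Proof.
move=> P0 /andP[t0 t1] s0 Dx Dy Dz Dw fxy.
apply: le_inf_ratio => // i Pi.
have ax := inf_ratio_mul_le Pi Dx; have ay := inf_ratio_mul_le Pi Dy.
have az : a i z = a i x + t * (a i y - a i x) by rewrite affa.
have bz : b i z = b i x + t * (b i y - b i x) by rewrite affb.
(* The point y is a convex combination of z and of the end of the prolonged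
   segment, where the denominator is positive. *)
have k1 : (1 + s) * b i y >= s * b i z.
  have : b i y = b i z + (1 + s)^-1 * (b i (y + s *: (y - z)) - b i z).
    rewrite -(affb Pi); congr (b i _).
    rewrite [y + _ - z]addrAC -[X in X + s *: _]scale1r -scalerDl scalerA.
    by rewrite mulVf ?scale1r ?subrKC// gt_eqF//; lra.
  move=> ->; rewrite mulrDr mulVKf ?gt_eqF ?addr_gt0//.
  by have := b_gt0 Pi Dw; lra.
have k2 : s / (1 + s) * b i z <= b i y.
  by rewrite mulrAC ler_pdivrMr ?[b i y * _]mulrC//; lra.
have b0 := b_gt0 Pi Dz.
rewrite mulrDl -!mulrA mulrA [X in _ + X](_ : _ =
  t * (inf_ratio y - inf_ratio x) * (s / (1 + s) * b i z)); last first.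
  by field; rewrite gt_eqF//; lra.
have k3 : t * (inf_ratio y - inf_ratio x) * (s / (1 + s) * b i z) <=
          t * (inf_ratio y - inf_ratio x) * b i y.
  by rewrite ler_wpM2l ?mulr_ge0 ?subr_ge0.
rewrite az; apply: (@le_trans _ _ (inf_ratio x * b i z +
  t * (inf_ratio y - inf_ratio x) * b i y)); first by rewrite lerD2l.
rewrite bz.
have := ler_wpM2l t0 ay; have : (1 - t) * (inf_ratio x * b i x) <= (1 - t) * a i x.
  by rewrite ler_wpM2l ?subr_ge0.
by lra.
Qed.

(** The chord estimate is applied between zeta = p.1 + p.2 (x - y) and its
translate omega by y - x; p.1 is the point of this chord at the parameter p.2.
The estimate is uniform because zeta and omega tend to x and y, so that the
difference of their values is eventually at least a third of f(y) - f(x). *)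
Lemma inf_ratio_clarke_lt0 x y : D x -> D y -> inf_ratio x < inf_ratio y ->
  (clarke_derivative inf_ratio x (x - y)%R < 0)%E.
Proof.
move=> Dx Dy fxy; have [P0|/set0P P0] := eqVneq P set0.
  by move: fxy; rewrite !inf_ratio_set0 ?ltxx.
have [s s0 Ds] : exists2 s : R, 0 < s & D (y + s *: (y - x)).
  have cs : y + s *: (y - x) @[s --> at_right (0 : R)] --> y.
    rewrite -[X in _ --> X]addr0 -(scale0r (y - x)).
    apply: cvgD; first exact: cvg_cst.
    by apply: cvgZr_tmp; exact: cvg_within.
  have : \forall s \near at_right (0 : R), 0 < s /\ D (y + s *: (y - x)).
    near=> s; split; first by near: s; exact: nbhs_right_gt.
    by near: s; apply: cs; exact: open_nbhs_nbhs.
  by move=> /filter_ex[s []]; exists s.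
set k := s / (1 + s); have k0 : 0 < k by rewrite divr_gt0// addr_gt0.
pose e := (inf_ratio y - inf_ratio x) / 3.
have e0 : 0 < e by rewrite divr_gt0// subr_gt0.
pose F := filter_prod (nbhs x) (at_right (0 : R)).
pose zeta (p : X * R) := p.1 + p.2 *: (x - y).
pose omega (p : X * R) := zeta p + (y - x).
have cfst : p.1 @[p --> F] --> x by exact: cvg_fst.
have csnd : p.2 @[p --> F] --> (0 : R).
  by apply: cvg_trans cvg_snd _; exact: cvg_within.
have czeta : zeta p @[p --> F] --> x.
  rewrite -[X in _ --> X]addr0 -(scale0r (x - y)).
  by apply: cvgD => //; exact: cvgZr_tmp.
have comega : omega p @[p --> F] --> y.
  rewrite -[X in _ --> X](subrKC x).
  by apply: cvgD => //; exact: cvg_cst.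
have cw : omega p + s *: (omega p - p.1) @[p --> F] --> y + s *: (y - x).
  by apply: cvgD => //; apply: cvgZl_tmp; exact: cvgB.
have fcont v (g : X * R -> X) : D v -> g p @[p --> F] --> v ->
    \forall p \near F, `|inf_ratio v - inf_ratio (g p)| < e.
  move=> Dv gv; have := locally_lipschitz_continuous inf_ratio_lipschitz Dv.
  move=> /(continuous_cvg _) /(_ gv) /cvgr_dist_lt; exact.
have inD v (g : X * R -> X) : D v -> g p @[p --> F] --> v ->
    \forall p \near F, D (g p).
  by move=> Dv gv; apply: gv; exact: open_nbhs_nbhs.
apply: (@le_lt_trans _ _ (- (k * e))%:E); last first.
  by rewrite lte_fin oppr_lt0 mulr_gt0.
have quot : F [set p |
    (inf_ratio (p.1 + p.2 *: (x - y)) - inf_ratio p.1) / p.2 <= - (k * e)].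
  near=> p => /=; rewrite -/(zeta p).
  have p0 : 0 < p.2.
    near: p; have : \forall t \near at_right (0 : R), 0 < t by exact: nbhs_right_gt.
    exact: cvg_snd.
  have p1 : p.2 <= 1.
    near: p; have : \forall t \near at_right (0 : R), t <= 1 by exact: nbhs_right_le.
    exact: cvg_snd.
  have fz : `|inf_ratio x - inf_ratio (zeta p)| < e by near: p; exact: fcont.
  have fw : `|inf_ratio y - inf_ratio (omega p)| < e by near: p; exact: fcont.
  have fzw : e <= inf_ratio (omega p) - inf_ratio (zeta p).
    by move: fz fw; rewrite !ltr_norml /e; lra.
  have p1E : zeta p + p.2 *: (omega p - zeta p) = p.1.
    have -> : omega p - zeta p = y - x by rewrite /omega [_ + (y - x)]addrC addrK.
    by rewrite -(opprB x y) scalerN addrK.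
  have := @inf_ratio_chord_increase (zeta p) (omega p) p.2 s.
  rewrite p1E -/k (ltW p0) p1 => /(_ P0 isT s0) H.
  have {}H : inf_ratio (zeta p) + p.2 * k * (inf_ratio (omega p) - inf_ratio (zeta p))
      <= inf_ratio p.1.
    apply: H.
    - by near: p; exact: (inD x).
    - by near: p; exact: (inD y).
    - by near: p; exact: (inD x).
    - by near: p; exact: (inD (y + s *: (y - x))).
    - by lra.
  rewrite ler_pdivrMr//.
  have : p.2 * k * e <= p.2 * k * (inf_ratio (omega p) - inf_ratio (zeta p)).
    by rewrite ler_wpM2l// ltW// mulr_gt0.
  by move: H; lra.
rewrite /clarke_derivative limf_esupE; apply: ge_ereal_inf.
eexists; first by eexists; [exact: quot|reflexivity].
by apply: ge_ereal_sup => _ [p /= hp <-]; rewrite lee_fin.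
Unshelve. all: by end_near. Qed.

Lemma inf_ratio_pseudo_concave : pseudo_concave_on D inf_ratio.
Proof.
split=> [|x y g Dx Dy [_ gle] fxy]; first exact: inf_ratio_lipschitz.
have := le_lt_trans (gle (x - y)) (inf_ratio_clarke_lt0 Dx Dy fxy).
by rewrite lte_fin -opprB linearN oppr_lt0.
Qed.

End inf_of_affine_ratios.

(** * Integrals with weights, as functions of a coefficient in L^oo *)

Section ae_le_integral.
Context d (T : measurableType d) (R : realType).
Variable mu : {measure set T -> \bar R}.

Lemma ae_le_Rintegral (f g : T -> R) :
  mu.-integrable setT (EFin \o f) -> mu.-integrable setT (EFin \o g) ->
  (\forall x \ae mu, f x <= g x) -> \int[mu]_x f x <= \int[mu]_x g x.
Proof.
move=> fi gi fg; rewrite -subr_ge0 -RintegralB//.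
have gfi : mu.-integrable setT (EFin \o (g \- f)).
  have -> : EFin \o (g \- f) = ((EFin \o g) \- (EFin \o f))%E by [].
  exact: integrableB.
rewrite /Rintegral (@ae_eq_integral _ _ _ mu _ (fun x => abse (EFin (g x - f x))))//.
- by rewrite fine_ge0// integral_ge0.
- exact: measurable_int gfi.
- exact: (measurable_int _ (integrable_abse gfi)).
- by move: fg; apply: filterS => x fg _; rewrite /= ger0_norm ?subr_ge0.
Qed.

Lemma Rintegral_sqr_gt0 (u : T -> R) : u \in Lfun mu 2%:E ->
  ~ (u = cst 0 %[ae mu]) -> 0 < \int[mu]_x (u x ^+ 2).
Proof.
move=> u2 un0; have ui := Lfun2_integrable_sqr u2.
rewrite lt_neqAle Rintegral_ge0 ?andbT; last by move=> x _; exact: sqr_ge0.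
apply/eqP => u0; apply: un0.
have uE : (\int[mu]_x (EFin \o (fun x => u x ^+ 2)%R) x)%E = 0%E.
  have := fineK (integrable_fin_num measurableT ui) => <-.
  by congr EFin; rewrite u0.
have /(ae_eq_integral_abs _ measurableT (measurable_int _ ui)) :
    (\int[mu]_x `|(EFin \o (fun x => u x ^+ 2)%R) x|)%E = 0%E.
  by rewrite -[RHS]uE; apply: eq_integral => x _; rewrite /= ger0_norm ?sqr_ge0.
apply: filterS => x /= /(_ I) [] /eqP; rewrite sqrf_eq0 => /eqP //.
Qed.
End ae_le_integral.

Section Linfty_weight.
Context d (T : measurableType d) (R : realType).
Variable mu : {measure set T -> \bar R}.
Local Notation Loo := (LspaceType mu (leey 1%E)).
Implicit Types (theta : Loo) (w : T -> R).

Lemma measurable_Linfty theta : measurable_fun setT (theta : T -> R).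
Proof. exact: (@measurable_funPT _ _ _ _ (Lrepr theta : {mfun T >-> R})). Qed.

Lemma LspaceB theta theta' :
  ((theta - theta')%R : T -> R) = (fun x => theta x - theta' x) %[ae mu].
Proof.
have := LspaceN theta'; have := LspaceD theta (- theta').
by apply: filterS2 => x /= /(_ I) e1 /(_ I) e2 _; rewrite e1 e2.
Qed.

Lemma Lspace_segment theta theta' (t : R) :
  ((theta + t *: (theta' - theta))%R : T -> R) =
    (fun x => theta x + t * (theta' x - theta x)) %[ae mu].
Proof.
have := LspaceD theta (t *: (theta' - theta)).
have := LspaceZ t (theta' - theta); have := LspaceB theta' theta.
by apply: filterS3 => x /= /(_ I) e1 /(_ I) e2 /(_ I) e3 _; rewrite e3 e2 e1.
Qed.

Lemma Linfty_ae_le_norm theta : \forall x \ae mu, `|theta x| <= `|theta|.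
Proof.
have := finite_norm_fine (Lrepr theta); rewrite -[fine _]/(`|theta|) unlock.
case: ifPn => [_ nE|].
  have := ess_sup_ge mu (abse \o (EFin \o Lrepr theta)).
  by apply: filterS => x; rewrite -nE lee_fin.
(* The norm of L^oo is 0 by convention when mu = 0, but then every property holds
   almost everywhere. *)
rewrite lt0e measure_ge0 andbT negbK => /eqP mu0 _.
by exists setT; split => // ; exact: measurableT.
Qed.

Lemma integrable_Linfty_mul theta w :
  mu.-integrable setT (EFin \o w) ->
  mu.-integrable setT (EFin \o (fun x => theta x * w x)).
Proof.
move=> wi; have mw : measurable_fun setT w.
  exact/measurable_EFinP/(measurable_int _ wi).
have mtw : measurable_fun setT (fun x => theta x * w x).
  by apply: measurable_funM => //; exact: measurable_Linfty.
apply/integrableP; split; first exact/measurable_EFinP.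
apply: (@le_lt_trans _ _ (\int[mu]_x `|(`|theta| * w x)%R%:E|)%E).
  apply: ae_ge0_le_integral => //.
  - by apply: measurableT_comp => //; exact/measurable_EFinP.
  - apply: measurableT_comp => //; apply/measurable_EFinP.
    exact: measurable_funM.
  - have := Linfty_ae_le_norm theta; apply: filterS => x tx _.
    by rewrite /= lee_fin !normrM normr_id ler_wpM2r.
have /integrableP[] := integrableZl measurableT `|theta| wi.
by [].
Qed.

Lemma integrable_coefficient_mul (c k : R) theta w :
  mu.-integrable setT (EFin \o w) ->
  mu.-integrable setT (EFin \o (fun x => (c + k * theta x) * w x)).
Proof.
move=> wi; have twi := integrable_Linfty_mul theta wi.
rewrite (_ : _ \o _ = (fun x => c%:E * (w x)%:E) \+
  (fun x => k%:E * (theta x * w x)%R%:E))%E; last first.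
  by apply/funext => x; rewrite /= -!EFinM -EFinD mulrDl mulrA.
by apply: integrableD => //; exact: integrableZl.
Qed.

Definition weighted_integral (c k : R) w theta : R :=
  \int[mu]_x ((c + k * theta x) * w x).

(** Sums and multiples in L^oo are computed on representatives only up to null
sets, so the pointwise affine identity of the integrands holds almost
everywhere. *)
Lemma weighted_integral_affine c k w : mu.-integrable setT (EFin \o w) ->
  affine_functional (weighted_integral c k w : Loo -> R).
Proof.
move=> wi theta theta' t; rewrite /weighted_integral.
have i1 := integrable_coefficient_mul c k theta wi.
have i2 := integrable_coefficient_mul c k theta' wi.
have i3 : mu.-integrable setT (EFin \o (fun x =>
    (c + k * theta' x) * w x - (c + k * theta x) * w x)).
  have := integrableB measurableT i2 i1.
  by rewrite (_ : (_ \- _)%E = EFin \o (fun x =>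
    (c + k * theta' x) * w x - (c + k * theta x) * w x)%R).
rewrite -RintegralB// -RintegralZl// -RintegralD//; last first.
  exact: (integrableZl measurableT t i3).
congr fine; apply: ae_eq_integral => //.
- exact: (measurable_int _ (integrable_coefficient_mul c k _ wi)).
- exact: (measurable_int _ (integrableD measurableT i1
    (integrableZl measurableT t i3))).
have := Lspace_segment theta theta' t.
by apply: filterS => x /= /(_ I) -> _; congr EFin; ring.
Qed.

Lemma le_weighted_integral m c k w theta : mu.-integrable setT (EFin \o w) ->
  (forall x, 0 <= w x) -> (\forall x \ae mu, m <= c + k * theta x) ->
  m * \int[mu]_x w x <= weighted_integral c k w theta.
Proof.
move=> wi w0 mtheta; rewrite -RintegralZl//; apply: ae_le_Rintegral.
- exact: (integrableZl measurableT m wi).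
- exact: integrable_coefficient_mul.
- by move: mtheta; apply: filterS => x; exact: ler_wpM2r.
Qed.

Hypothesis mu_fin : (mu setT < +oo)%E.

Lemma integrable_cst_finite (c : R) : mu.-integrable setT (EFin \o cst c).
Proof.
apply/integrableP; split; first exact/measurable_EFinP.
rewrite (eq_integral (cst `|c|%:E)) ?integral_cst//.
by rewrite lte_mul_pinfty// lee_fin.
Qed.

Lemma weighted_integral_cst1 theta :
  weighted_integral 0 1 (cst 1) theta = \int[mu]_x theta x.
Proof. by apply: eq_Rintegral => x _; rewrite add0r mul1r mulr1. Qed.

Lemma integrable_Linfty theta : mu.-integrable setT (EFin \o theta).
Proof.
have := integrable_Linfty_mul theta (integrable_cst_finite 1).
by rewrite (_ : (fun x => _) = theta)//; apply/funext => x; rewrite mulr1.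
Qed.

Lemma Rintegral_Linfty_lipschitz theta theta' :
  `|\int[mu]_x theta x - \int[mu]_x theta' x| <= `|theta - theta'| * fine (mu setT).
Proof.
have di : mu.-integrable setT (EFin \o (fun x => theta x - theta' x)).
  have := integrableB measurableT (integrable_Linfty theta) (integrable_Linfty theta').
  by rewrite (_ : (_ \- _)%E = EFin \o (fun x => theta x - theta' x)%R).
rewrite -RintegralB ?integrable_Linfty// -(Rintegral_cst mu measurableT).
apply: le_trans (le_normr_Rintegral measurableT di) _.
apply: ae_le_Rintegral; [exact: integrable_norm|exact: integrable_cst_finite|].
have := LspaceB theta theta'; have := Linfty_ae_le_norm (theta - theta').
by apply: filterS2 => x le /(_ I) <-.
Qed.
End Linfty_weight.

(** * The admissible set *)

Section adstar_geometry.
Context (R : realType) (N : nat) (Omega : set 'rV[R]_N).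
Variable Omega_open : open Omega.
Local Notation mu := (domain_measure Omega_open).
Local Notation Loo := (Linfty Omega_open).

(** Omega lies in a cube, whose measure is known; the cube is measurable because
it is closed. *)
Lemma bounded_domain_measure_finite : bounded_set Omega -> (mu setT < +oo)%E.
Proof.
move=> [M [_ /(_ (`|M| + 1))]].
rewrite (le_lt_trans (ler_norm _)) ?ltrDl// => /(_ isT) OM.
set K := `|M| + 1 in OM; have K0 : 0 <= K by rewrite addr_ge0.
pose box := [set x : 'rV[R]_N | forall i,
  (const_mx (- K) : 'rV[R]_N) ord0 i <= x ord0 i <= (const_mx K : 'rV[R]_N) ord0 i].
have cbox : closed box.
  have -> : box = \bigcap_(i in [set: 'I_N])
      ((fun x : 'rV[R]_N => x ord0 i) @^-1` `[- K, K]%classic).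
    apply/seteqP; split => [x bx i _|x bx i].
      by have := bx i; rewrite !mxE /= in_itv.
    by have := bx i I; rewrite !mxE /= in_itv.
  apply: closed_bigI => i _; apply: closed_comp; last exact: itv_closed.
  by move=> x _; exact: coord_continuous.
have mbox : measurable box.
  rewrite -(setCK box); apply: measurableC; apply: open_measurable_rV.
  exact: closed_openC.
rewrite /domain_measure /= /mrestr setTI.
apply: (@le_lt_trans _ _ (lebesgue_rV box)).
  apply: le_measure; rewrite ?inE//; first exact: open_measurable_rV.
  move=> x Ox i; rewrite !mxE -ler_norml; apply: le_trans (OM _ Ox).
  rewrite [leRHS](mx_normrE x).
  exact: (le_bigmax _ (fun ij : 'I_1 * 'I_N => `|x ij.1 ij.2|) (ord0, i)).
by rewrite lebesgue_rV_box ?ltry// => i; rewrite !mxE; lra.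
Qed.

Variable gamma : R.

Lemma adstar_segment x y t : (mu setT < +oo)%E -> 0 <= t <= 1 ->
  adstar Omega_open gamma x -> adstar Omega_open gamma y ->
  adstar Omega_open gamma (x + t *: (y - x)).
Proof.
move=> mu_fin /andP[t0 t1] [x01 xg] [y01 yg]; split.
  have := Lspace_segment x y t; move: x01 y01.
  by apply: filterS3 => z /andP[x0 x1] /andP[y0 y1] /(_ I) ->; nra.
have := weighted_integral_affine 0 1 (integrable_cst_finite mu_fin 1) x y t.
by rewrite !weighted_integral_cst1 xg yg subrr mulr0 addr0.
Qed.

(** The pointwise bounds pass to the limit through the countably many tolerances
1 / (n + 1), which share one null set.  The integral is continuous for the norm of
L^oo because Omega has finite measure. *)
Lemma adstar_closed : (mu setT < +oo)%E -> closed (adstar Omega_open gamma).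
Proof.
move=> mu_fin theta cl.
have {cl} cl e : 0 < e -> exists2 theta', adstar Omega_open gamma theta' &
    `|theta - theta'| < e.
  move=> e0; have [theta' [at' bt]] := cl _ (nbhsx_ballx theta e e0).
  by exists theta' => //; move: bt; rewrite -ball_normE.
split.
  have be e : 0 < e -> \forall x \ae mu, - e <= theta x <= 1 + e.
    move=> e0; have [theta' [t01 _] tt] := cl e e0.
    move: t01 (LspaceB theta theta') (Linfty_ae_le_norm (theta - theta')).
    apply: filterS3 => x /andP[h0 h1] /(_ I) -> h2.
    by have := le_trans h2 (ltW tt); rewrite ler_norml => /andP[h3 h4]; lra.
  have bn n := be n.+1%:R^-1 (ltac:(by [])).
  have := ae_foralln bn; apply: filterS => x hx.
  apply/andP; split; apply/ler_addgt0Pr => e e0;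
    have [n ne] := filter_ex (near_infty_natSinv_lt (PosNum e0));
    by move: (hx n) ne => /=; move: n.+1%:R^-1 => i /andP[h0 h1] ie; lra.
apply/eqP; rewrite -subr_eq0 -normr_le0; apply/ler_addgt0Pr => e e0.
set V := fine (mu setT); have V0 : 0 <= V by rewrite fine_ge0.
have [theta' [_ <-] tt] := cl (e / (V + 1)) ltac:(by rewrite divr_gt0// ltr_wpDl).
apply: le_trans (Rintegral_Linfty_lipschitz mu_fin theta theta') _.
rewrite add0r; apply: le_trans (ler_wpM2r V0 (ltW tt)) _.
by rewrite mulrAC ler_pdivrMr ?ltr_wpDl// ler_wpM2l ?(ltW e0)// lerDl.
Qed.

End adstar_geometry.

(** * The first eigenvalue as an infimum of ratios *)

Section eigenvalue_as_inf_ratio.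
Context (R : realType) (N : nat) (Omega : set 'rV[R]_N).
Variable Omega_open : open Omega.
Local Notation mu := (domain_measure Omega_open).
Local Notation Loo := (Linfty Omega_open).

Lemma integrable_norm2 (G : 'rV[R]_N -> 'rV[R]_N) :
  (forall i, (fun x => G x ord0 i) \in Lfun mu 2%:E) ->
  mu.-integrable setT (EFin \o (fun x => norm2 (G x))).
Proof.
move=> G2; rewrite (_ : _ \o _ =
    (fun x => \sum_(i < N) (EFin \o (fun x => G x ord0 i ^+ 2)%R) x)%E).
  by apply: integrable_sum => // i _; exact: Lfun2_integrable_sqr.
by apply/funext => x; rewrite /= /norm2 sumEFin.
Qed.

Variables c1 c2 rho1 rho2 : R.

Definition competitors : set (('rV[R]_N -> R) * ('rV[R]_N -> 'rV[R]_N)) :=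
  [set p | H10 Omega_open p.1 p.2 /\ ~ (p.1 = cst 0 %[ae mu])].

Definition stiffness (p : ('rV[R]_N -> R) * ('rV[R]_N -> 'rV[R]_N)) (theta : Loo) :=
  weighted_integral c1 (c2 - c1) (fun x => norm2 (p.2 x)) theta.

Definition mass (p : ('rV[R]_N -> R) * ('rV[R]_N -> 'rV[R]_N)) (theta : Loo) :=
  weighted_integral rho1 (rho2 - rho1) (fun x => p.1 x ^+ 2) theta.

Lemma lambda1_inf_ratio : lambda1 Omega_open c1 c2 rho1 rho2 =
  inf_ratio competitors stiffness mass.
Proof.
apply/funext => theta; congr inf; apply/seteqP; split.
  by move=> _ [u [G [uG u0 ->]]]; exists (u, G).
by move=> _ [[u G] [uG u0] <-]; exists u, G.
Qed.

(** The bound m makes the numerators nonnegative, and the denominators at least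
m times the squared norm of u in L^2, which is positive for a competitor. *)
Lemma lambda1_pseudo_concave (D : set Loo) (m : R) : open D -> 0 < m ->
  (forall theta, D theta -> \forall x \ae mu,
     m <= c1 + (c2 - c1) * theta x /\ m <= rho1 + (rho2 - rho1) * theta x) ->
  pseudo_concave_on D (lambda1 Omega_open c1 c2 rho1 rho2).
Proof.
move=> oD m0 coef; rewrite lambda1_inf_ratio.
apply: inf_ratio_pseudo_concave => //.
- by move=> p [[[_ p2 _] _] _]; apply: weighted_integral_affine; exact: integrable_norm2.
- move=> p [[[u2 _ _] _] _]; apply: weighted_integral_affine.
  exact: Lfun2_integrable_sqr.
- move=> p theta [[[_ p2 _] _] _] Dtheta.
  apply: (@le_trans _ _ (m * \int[mu]_x norm2 (p.2 x))).
    rewrite mulr_ge0 ?(ltW m0)// Rintegral_ge0// => x _.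
    by apply: sumr_ge0 => i _; exact: sqr_ge0.
  apply: le_weighted_integral; first exact: integrable_norm2.
    by move=> x; apply: sumr_ge0 => i _; exact: sqr_ge0.
  by move: (coef _ Dtheta); apply: filterS => x [].
- move=> p theta [[[u2 _ _] _] u0] Dtheta.
  apply: (@lt_le_trans _ _ (m * \int[mu]_x p.1 x ^+ 2)).
    by rewrite mulr_gt0// Rintegral_sqr_gt0.
  apply: le_weighted_integral; first exact: Lfun2_integrable_sqr.
    by move=> x; exact: sqr_ge0.
  by move: (coef _ Dtheta); apply: filterS => x [].
Qed.

(** A neighbourhood of the admissible set of uniform radius e is open, and convex
as a neighbourhood of a convex set.  On it the coefficients are at least
c1 - e (c2 - c1) and rho1 - e (rho2 - rho1); e is chosen so that these bounds are
at least c1 / 2 and rho1 / 2. *)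
Lemma exists_admissible_extension_domain gamma : (mu setT < +oo)%E ->
  0 < c1 -> c1 < c2 -> 0 < rho1 -> rho1 < rho2 ->
  exists D, admissible_extension_domain Omega_open c1 c2 rho1 rho2 gamma D.
Proof.
move=> mu_fin c10 c12 r10 r12.
pose e := Num.min (c1 / (2 * (c2 - c1))) (rho1 / (2 * (rho2 - rho1))).
have e0 : 0 < e by rewrite lt_min !divr_gt0 ?mulr_gt0 ?subr_gt0.
have ec : e * (c2 - c1) <= c1 / 2.
  have -> : c1 / 2 = c1 / (2 * (c2 - c1)) * (c2 - c1).
    by field; rewrite subr_eq0 gt_eqF.
  by rewrite ler_wpM2r ?subr_ge0 ?(ltW c12)// ge_min lexx.
have er : e * (rho2 - rho1) <= rho1 / 2.
  have -> : rho1 / 2 = rho1 / (2 * (rho2 - rho1)) * (rho2 - rho1).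
    by field; rewrite subr_eq0 gt_eqF.
  by rewrite ler_wpM2r ?subr_ge0 ?(ltW r12)// ge_min lexx orbT.
exists (\bigcup_(theta in adstar Omega_open gamma) ball theta e); split.
- by apply: bigcup_open => theta _; exact: ball_open.
- apply: segment_convex_set => x y t t01 [x' ax] bx [y' ay] by'.
  exists (x' + t *: (y' - x')); first exact: adstar_segment.
  move: bx by'; rewrite -ball_normE /= => bx by'.
  have -> : x' + t *: (y' - x') - (x + t *: (y - x)) =
      (1 - t) *: (x' - x) + t *: (y' - y).
    rewrite opprD addrACA -scalerBr scalerBl scale1r -[RHS]addrA; congr (_ + _).
    rewrite [RHS]addrC -scalerBr; congr (_ *: _).
    by rewrite !opprB addrACA [RHS]addrACA [- x' - y]addrC.
  move: t01 => /andP[t0 t1].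
  apply: le_lt_trans (ler_normD _ _) _; rewrite !normrZ !ger0_norm ?subr_ge0//.
  (* For t = 0 the strict bound on the distance of y and y' is multiplied by 0. *)
  have [->|tn0] := eqVneq t 0; first by rewrite mul0r addr0 subr0 mul1r.
  have tp : 0 < t by rewrite lt_neqAle eq_sym tn0.
  by nra.
- by move=> theta a; exists theta => //; exact: ballxx.
- exists (Num.min (c1 / 2) (rho1 / 2)), (Num.max (c2 + c1) (rho2 + rho1)).
  split; first by rewrite lt_min !divr_gt0.
  move=> theta [theta' [t01 _]]; rewrite -ball_normE /= => tt.
  move: t01 (LspaceB theta' theta) (Linfty_ae_le_norm (theta' - theta)).
  apply: filterS3 => x /andP[h0 h1] /(_ I) -> h2.
  have := le_trans h2 (ltW tt); rewrite ler_norml => /andP[h3 h4].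
  rewrite !ge_min !le_max.
  have k1 : c1 / 2 <= c1 + (c2 - c1) * theta x by nra.
  have k2 : rho1 / 2 <= rho1 + (rho2 - rho1) * theta x by nra.
  have k3 : c1 + (c2 - c1) * theta x <= c2 + c1 by nra.
  have k4 : rho1 + (rho2 - rho1) * theta x <= rho2 + rho1 by nra.
  by rewrite k1 k2 k3 k4 !orbT.
Qed.

End eigenvalue_as_inf_ratio.

Theorem theorem5 (R : realType) (N : nat) (Omega : set 'rV[R]_N)
    (Omega_open : open Omega) (gamma c1 c2 rho1 rho2 : R) :
  (0 < N)%N ->
  bounded_set Omega ->
  lipschitz_boundary Omega ->
  0 < gamma -> (gamma%:E < lebesgue_rV Omega)%E ->
  0 < c1 -> c1 < c2 ->
  0 < rho1 -> rho1 < rho2 ->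
  [/\ pseudo_concave_maximization (adstar Omega_open gamma)
        (lambda1 Omega_open c1 c2 rho1 rho2),
      forall D : set (Linfty Omega_open),
        admissible_extension_domain Omega_open c1 c2 rho1 rho2 gamma D ->
        pseudo_concave_on D (lambda1 Omega_open c1 c2 rho1 rho2) &
      forall theta : Linfty Omega_open,
        clarke_stationary (adstar Omega_open gamma)
          (lambda1 Omega_open c1 c2 rho1 rho2) theta ->
        global_maximizer (adstar Omega_open gamma)
          (lambda1 Omega_open c1 c2 rho1 rho2) theta].
Proof.
move=> _ bO _ _ _ c10 c12 r10 r12.
have mu_fin := bounded_domain_measure_finite Omega_open bO.
have pc D : admissible_extension_domain Omega_open c1 c2 rho1 rho2 gamma D ->
    pseudo_concave_on D (lambda1 Omega_open c1 c2 rho1 rho2).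
  move=> [oD _ _ [m [M [m0 mM]]]]; apply: (lambda1_pseudo_concave oD m0).
  by move=> theta /mM; apply: filterS => x [/andP[? _] /andP[? _]].
have [D adD] := exists_admissible_extension_domain gamma mu_fin c10 c12 r10 r12.
have [oD cD sD _] := adD.
split => //.
  split; first exact: adstar_closed.
    by apply: segment_convex_set => x y t; exact: adstar_segment.
  by exists D, (lambda1 Omega_open c1 c2 rho1 rho2); split => //; exact: pc.
move=> theta [ad [g dg gle]]; split => // theta' ad'.
rewrite leNgt; apply/negP => lt.
have [_ /(_ theta theta' g (sD _ ad) (sD _ ad') dg lt)] := pc _ adD.
by rewrite ltNge gle.
Qed.
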